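(* Let $X$ be an infinite set and let $\mathcal{Z}\subseteq\mathcal{P}(X)$ be closed under finite unions with $[X]^{<\omega}\subseteq\mathcal{Z}$. Then (in $\mathbf{ZF}$) the space $2^X[\mathcal{Z}]$ is homogeneous.
   Context: The background theory is $\mathbf{ZF}$ (no axiom of choice). $[X]^{<\omega}$ is the set of finite subsets of $X$, and $2=\{0,1\}$. For $z\in\mathcal{Z}\setminus\{\emptyset\}$ and $p\in 2^z$, $[p]_X=\{f\in 2^X:p\subseteq f\}$. $\tau_2[\mathcal{Z}]=\{V\subseteq 2^X:(\forall f\in V)(\exists z\in\mathcal{Z}\setminus\{\emptyset\})(\exists p\in 2^z)\ f\in[p]_X\subseteq V\}$ is a topology on $2^X$, and $2^X[\mathcal{Z}]=\langle 2^X,\tau_2[\mathcal{Z}]\rangle$. A topological space is homogeneous if for every pair $x_1,x_2$ of distinct points there is an autohomeomorphism $h$ of the space with $h(x_1)=x_2$. *)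

(* Defs.v *)
From Stdlib Require Import ClassicalEpsilon.

(** "In ZF" is rendered semantically: the theorem is about the sets of an
    arbitrary model of first-order Zermelo-Fraenkel set theory.  The two schemes
    range over first-order formulas with parameters, not over arbitrary Rocq
    predicates: with the latter, a choice principle of the ambient logic would
    make the axiom of choice true in every model. *)

(** De Bruijn variables: in [fAll p] and [fEx p] the bound variable is [0]. *)
Inductive formula : Type :=
| fMem (i j : nat)
| fEq (i j : nat)
| fNot (p : formula)
| fAnd (p q : formula)
| fOr (p q : formula)
| fImp (p q : formula)
| fAll (p : formula)
| fEx (p : formula).

Definition scons {M : Type} (x : M) (e : nat -> M) (n : nat) : M :=
  match n with O => x | S k => e k end.

Fixpoint sat {M : Type} (E : M -> M -> Prop) (e : nat -> M) (p : formula)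
    : Prop :=
  match p with
  | fMem i j => E (e i) (e j)
  | fEq i j => e i = e j
  | fNot p => ~ sat E e p
  | fAnd p q => sat E e p /\ sat E e q
  | fOr p q => sat E e p \/ sat E e q
  | fImp p q => sat E e p -> sat E e q
  | fAll p => forall x, sat E (scons x e) p
  | fEx p => exists x, sat E (scons x e) p
  end.

Record ZF_model : Type := {
  carrier :> Type;
  mem : carrier -> carrier -> Prop;
  zf_extensionality :
    forall a b, (forall x, mem x a <-> mem x b) -> a = b;
  zf_foundation :
    forall a, (exists x, mem x a) ->
      exists x, mem x a /\ ~ exists y, mem y x /\ mem y a;
  zf_pairing :
    forall a b, exists c, forall x, mem x c <-> x = a \/ x = b;
  zf_union :
    forall a, exists u, forall x, mem x u <-> exists y, mem y a /\ mem x y;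
  zf_power :
    forall a, exists b, forall x,
      mem x b <-> forall y, mem y x -> mem y a;
  zf_infinity :
    exists w,
      (exists o, mem o w /\ forall x, ~ mem x o) /\
      (forall x, mem x w ->
         exists s, mem s w /\ forall y, mem y s <-> mem y x \/ y = x);
  zf_separation :
    forall (p : formula) (e : nat -> carrier) a, exists b, forall x,
      mem x b <-> mem x a /\ sat mem (scons x e) p;
  (* variable 0 is the value and variable 1 the argument *)
  zf_replacement :
    forall (p : formula) (e : nat -> carrier) a,
      (forall x, mem x a -> exists! y, sat mem (scons y (scons x e)) p) ->
      exists b, forall y,
        mem y b <-> exists x, mem x a /\ sat mem (scons y (scons x e)) p
}.

Arguments mem {_} _ _.

Declare Scope zf_scope.
Delimit Scope zf_scope with zf.
Local Open Scope zf_scope.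

Notation "x ∈ y" := (mem x y) (at level 70, no associativity) : zf_scope.

Definition subset {U : ZF_model} (a b : U) : Prop := forall x, x ∈ a -> x ∈ b.

Notation "a ⊆ b" := (subset a b) (at level 70, no associativity) : zf_scope.

Lemma ZF_model_inhabited (U : ZF_model) : inhabited U.
Proof. destruct (zf_infinity U) as [w _]. exact (inhabits w). Qed.

(** The set of the model whose elements are exactly the [x] with [P x]; it is
    unique by extensionality, and unspecified if there is no such set.  For every
    use below, ZF proves that the set exists.  As only a uniquely determined
    object is picked, no choice is introduced inside the model. *)
Definition setof {U : ZF_model} (P : U -> Prop) : U :=
  epsilon (ZF_model_inhabited U) (fun s => forall x, x ∈ s <-> P x).

Definition empty {U : ZF_model} : U := setof (fun _ => False).
Definition upair {U : ZF_model} (a b : U) : U := setof (fun x => x = a \/ x = b).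
Definition opair {U : ZF_model} (a b : U) : U := upair (upair a a) (upair a b).
Definition union {U : ZF_model} (a : U) : U :=
  setof (fun x => exists y, y ∈ a /\ x ∈ y).
Definition inter {U : ZF_model} (a b : U) : U :=
  setof (fun x => x ∈ a /\ x ∈ b).
Definition power {U : ZF_model} (a : U) : U := setof (fun x => x ⊆ a).
Definition succ {U : ZF_model} (x : U) : U := union (upair x (upair x x)).

Definition inductive {U : ZF_model} (w : U) : Prop :=
  empty ∈ w /\ forall x, x ∈ w -> succ x ∈ w.
Definition omega {U : ZF_model} : U :=
  setof (fun n => forall w, inductive w -> n ∈ w).

(** Functions are sets of Kuratowski pairs. *)
Definition function {U : ZF_model} (A B f : U) : Prop :=
  (forall q, q ∈ f -> exists a b, a ∈ A /\ b ∈ B /\ q = opair a b) /\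
  (forall a, a ∈ A -> exists! b, opair a b ∈ f).
Definition bijection {U : ZF_model} (A B f : U) : Prop :=
  function A B f /\ forall b, b ∈ B -> exists! a, opair a b ∈ f.

Definition finite {U : ZF_model} (a : U) : Prop :=
  exists n f : U, n ∈ omega /\ bijection n a f.
Definition infinite {U : ZF_model} (a : U) : Prop := ~ finite a.
Definition finite_subsets {U : ZF_model} (X : U) : U :=
  setof (fun a => a ⊆ X /\ finite a).

Definition closed_under_finite_unions {U : ZF_model} (Z : U) : Prop :=
  forall F : U, F ⊆ Z -> finite F -> union F ∈ Z.

Definition two {U : ZF_model} : U := upair empty (succ empty).

(** [pow2 A] is the set 2^A of all functions from A to 2. *)
Definition pow2 {U : ZF_model} (A : U) : U := setof (function A two).

(** [basic X p] is [p]_X. *)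
Definition basic {U : ZF_model} (X p : U) : U :=
  setof (fun f => f ∈ pow2 X /\ p ⊆ f).

Definition tau2 {U : ZF_model} (X Z : U) : U :=
  setof (fun V => V ⊆ pow2 X /\
    forall f, f ∈ V ->
      exists z, z ∈ Z /\ z <> empty /\
        exists p, p ∈ pow2 z /\ f ∈ basic X p /\ basic X p ⊆ V).

Definition is_topology {U : ZF_model} (S T : U) : Prop :=
  T ⊆ power S /\ empty ∈ T /\ S ∈ T /\
  (forall A, A ⊆ T -> union A ∈ T) /\
  (forall V W, V ∈ T -> W ∈ T -> inter V W ∈ T).

Definition preimage {U : ZF_model} (h V : U) : U :=
  setof (fun x => exists y, y ∈ V /\ opair x y ∈ h).
Definition converse {U : ZF_model} (h : U) : U :=
  setof (fun q => exists x y, opair x y ∈ h /\ q = opair y x).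

Definition continuous {U : ZF_model} (S T S' T' h : U) : Prop :=
  function S S' h /\ forall V, V ∈ T' -> preimage h V ∈ T.
Definition homeomorphism {U : ZF_model} (S T S' T' h : U) : Prop :=
  bijection S S' h /\ continuous S T S' T' h /\
  continuous S' T' S T (converse h).

(** The pair (S, T) is a homogeneous topological space. *)
Definition homogeneous {U : ZF_model} (S T : U) : Prop :=
  is_topology S T /\
  forall x1 x2, x1 ∈ S -> x2 ∈ S -> x1 <> x2 ->
    exists h, homeomorphism S T S T h /\ opair x1 x2 ∈ h.

(* Main.v *)
From Stdlib Require Import Classical ClassicalEpsilon.
Require Import Defs.
Local Open Scope zf_scope.

(** For [f], [g] in 2^X write [f ~z g] if they agree on [z].  A set [V] is open
    iff every [f] in [V] has a nonempty [z] in Z such that [V] contains each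
    [g ~z f].  Given [x1], [x2], the involution [f |-> f + x1 + x2 (mod 2)]
    preserves every relation [~z], hence is a homeomorphism, and it maps [x1]
    to [x2].  No choice is made: the involution is given by a formula with
    parameters [x1], [x2]. *)

(** * Definable predicates and separation *)

(** This bridges Rocq predicates and the first-order schemes: a single formula must express [P] in
    every environment, and parameters enter only as values of the environment. *)
Definition definable {U : ZF_model} (P : (nat -> U) -> Prop) : Prop :=
  exists p, forall e, sat mem e p <-> P e.

Lemma definable_ext {U : ZF_model} (P Q : (nat -> U) -> Prop) :
  definable P -> (forall e, P e <-> Q e) -> definable Q.
Proof. intros [p Hp] H. exists p. intro e. rewrite Hp. apply H. Qed.

Lemma definable_mem {U : ZF_model} i j : definable (fun e : nat -> U => e i ∈ e j).
Proof. exists (fMem i j). simpl. tauto. Qed.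

Lemma definable_eq {U : ZF_model} i j : definable (fun e : nat -> U => e i = e j).
Proof. exists (fEq i j). simpl. tauto. Qed.

Lemma definable_not {U : ZF_model} (P : (nat -> U) -> Prop) :
  definable P -> definable (fun e => ~ P e).
Proof. intros [p Hp]. exists (fNot p). intro e. simpl. rewrite Hp. tauto. Qed.

Lemma definable_and {U : ZF_model} (P Q : (nat -> U) -> Prop) :
  definable P -> definable Q -> definable (fun e => P e /\ Q e).
Proof.
  intros [p Hp] [q Hq]. exists (fAnd p q). intro e. simpl. rewrite Hp, Hq. tauto.
Qed.

Lemma definable_or {U : ZF_model} (P Q : (nat -> U) -> Prop) :
  definable P -> definable Q -> definable (fun e => P e \/ Q e).
Proof.
  intros [p Hp] [q Hq]. exists (fOr p q). intro e. simpl. rewrite Hp, Hq. tauto.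
Qed.

Lemma definable_imp {U : ZF_model} (P Q : (nat -> U) -> Prop) :
  definable P -> definable Q -> definable (fun e => P e -> Q e).
Proof.
  intros [p Hp] [q Hq]. exists (fImp p q). intro e. simpl. rewrite Hp, Hq. tauto.
Qed.

Lemma definable_iff {U : ZF_model} (P Q : (nat -> U) -> Prop) :
  definable P -> definable Q -> definable (fun e => P e <-> Q e).
Proof. intros HP HQ. apply definable_and; apply definable_imp; assumption. Qed.

(** [P] takes the environment and the bound value separately, so that it unifies with the body of a
    quantifier. The premise then reads the value at index 0 and shifts the rest, as in [scons]. *)
Lemma definable_all {U : ZF_model} (P : (nat -> U) -> U -> Prop) :
  definable (fun e => P (fun n => e (S n)) (e 0)) ->
  definable (fun e => forall x, P e x).
Proof.
  intros [p Hp]. exists (fAll p). intro e. simpl.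
  split; intros H x; apply (Hp (scons x e)), H.
Qed.

Lemma definable_ex {U : ZF_model} (P : (nat -> U) -> U -> Prop) :
  definable (fun e => P (fun n => e (S n)) (e 0)) ->
  definable (fun e => exists x, P e x).
Proof.
  intros [p Hp]. exists (fEx p). intro e. simpl.
  split; intros [x H]; exists x; apply (Hp (scons x e)), H.
Qed.

Create HintDb definability.

(** The order matters: an equivalence is also a conjunction up to unfolding, and a negation an
    implication, so the specific rules come first. Unfolding [unique] exposes the quantifiers of
    [exists!]. *)
Ltac definability :=
  cbv beta; unfold unique;
  repeat (first
    [ solve [auto with definability]
    | apply definable_mem | apply definable_eq
    | apply definable_iff | apply definable_and | apply definable_or
    | apply definable_not | apply definable_imp
    | apply definable_ex | apply definable_all ]; cbv beta).

Lemma separation {U : ZF_model} (P : (nat -> U) -> Prop) (e : nat -> U) (a : U) :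
  definable P -> exists b, forall x, x ∈ b <-> x ∈ a /\ P (scons x e).
Proof.
  intros [p Hp]. destruct (zf_separation U p e a) as [b Hb].
  exists b. intro x. rewrite Hb, Hp. tauto.
Qed.

Lemma mem_setof {U : ZF_model} (P : U -> Prop) :
  (exists s, forall x, x ∈ s <-> P x) -> forall x, x ∈ setof P <-> P x.
Proof.
  intro H.
  exact (epsilon_spec (ZF_model_inhabited U)
           (fun s => forall x, x ∈ s <-> P x) H).
Qed.

(** Separation from the bound [a] supplies the set that [setof] needs. [Q] restates [P] inside [a],
    with defined constants turned into parameters held by [e]. *)
Lemma mem_setof_bounded {U : ZF_model} (P : U -> Prop) (Q : (nat -> U) -> Prop)
    (e : nat -> U) (a : U) :
  definable Q -> (forall x, P x <-> x ∈ a /\ Q (scons x e)) ->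
  forall x, x ∈ setof P <-> P x.
Proof.
  intros HQ H. apply mem_setof. destruct (separation Q e a HQ) as [b Hb].
  exists b. intro x. rewrite Hb, H. tauto.
Qed.

(** * Elementary sets *)

Lemma mem_empty {U : ZF_model} (x : U) : ~ x ∈ empty.
Proof.
  unfold empty. rewrite mem_setof; [tauto|].
  destruct (zf_infinity U) as [_ [[o [_ Ho]] _]].
  exists o. intro y. specialize (Ho y). tauto.
Qed.

Lemma eq_empty {U : ZF_model} (a : U) : a = empty <-> forall x, ~ x ∈ a.
Proof.
  split; [intros -> x; apply mem_empty|].
  intro H. apply zf_extensionality. intro x.
  specialize (H x). pose proof (mem_empty x). tauto.
Qed.

Lemma neq_empty {U : ZF_model} (a : U) : a <> empty <-> exists x, x ∈ a.
Proof.
  rewrite eq_empty. split.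
  - intro H. apply NNPP. firstorder.
  - firstorder.
Qed.

Lemma mem_upair {U : ZF_model} (a b x : U) : x ∈ upair a b <-> x = a \/ x = b.
Proof. unfold upair. apply (mem_setof (fun x => _)), zf_pairing. Qed.

Lemma mem_union {U : ZF_model} (a x : U) :
  x ∈ union a <-> exists y, y ∈ a /\ x ∈ y.
Proof. unfold union. apply (mem_setof (fun x => _)), zf_union. Qed.

Lemma mem_power {U : ZF_model} (a x : U) : x ∈ power a <-> x ⊆ a.
Proof. unfold power. apply (mem_setof (fun x => _)), zf_power. Qed.

Lemma mem_union_upair {U : ZF_model} (a b x : U) :
  x ∈ union (upair a b) <-> x ∈ a \/ x ∈ b.
Proof.
  rewrite mem_union. split.
  - intros [y [Hy Hx]]. apply mem_upair in Hy. destruct Hy as [-> | ->]; auto.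
  - intros [H | H]; eexists; (split; [apply mem_upair|exact H]); auto.
Qed.

Lemma mem_inter {U : ZF_model} (a b x : U) : x ∈ inter a b <-> x ∈ a /\ x ∈ b.
Proof.
  unfold inter.
  apply (mem_setof_bounded (fun x => _) (fun e => e 0 ∈ e 1) (fun _ => b) a);
    [definability | simpl; tauto].
Qed.

Lemma mem_succ {U : ZF_model} (a x : U) : x ∈ succ a <-> x ∈ a \/ x = a.
Proof. unfold succ. rewrite mem_union_upair, mem_upair. tauto. Qed.

Lemma eq_upair {U : ZF_model} (c a b : U) :
  c = upair a b <-> forall x, x ∈ c <-> x = a \/ x = b.
Proof.
  split; [intros -> x; apply mem_upair|].
  intro H. apply zf_extensionality. intro x. rewrite mem_upair. apply H.
Qed.

Lemma eq_succ {U : ZF_model} (c a : U) :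
  c = succ a <-> forall x, x ∈ c <-> x ∈ a \/ x = a.
Proof.
  split; [intros -> x; apply mem_succ|].
  intro H. apply zf_extensionality. intro x. rewrite mem_succ. apply H.
Qed.

Lemma upair_inj {U : ZF_model} (a b c d : U) :
  upair a b = upair c d -> a = c /\ b = d \/ a = d /\ b = c.
Proof.
  rewrite eq_upair. intro H.
  pose proof (H a) as Ha. pose proof (H b) as Hb.
  pose proof (H c) as Hc. pose proof (H d) as Hd.
  rewrite mem_upair in *. intuition congruence.
Qed.

Lemma opair_inj {U : ZF_model} (a b c d : U) :
  opair a b = opair c d <-> a = c /\ b = d.
Proof.
  split; [|intros [-> ->]; reflexivity].
  unfold opair. intro H. apply upair_inj in H.
  destruct H as [[H1 H2] | [H1 H2]];
    apply upair_inj in H1; apply upair_inj in H2; intuition congruence.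
Qed.

(** A superset of the product is enough: its only purpose is to bound later separations. *)
Lemma product_bound {U : ZF_model} (A B : U) :
  exists C, forall a b, a ∈ A -> b ∈ B -> opair a b ∈ C.
Proof.
  (* The two members of a Kuratowski pair are subsets of the union of [A] and [B]. *)
  exists (power (power (union (upair A B)))). intros a b Ha Hb.
  apply mem_power. intros u Hu. apply mem_power. intros x Hx.
  apply mem_union_upair. apply mem_upair in Hu.
  destruct Hu as [-> | ->]; apply mem_upair in Hx;
    destruct Hx as [-> | ->]; auto.
Qed.

(** * Definability of pairs, functions and inductive sets *)

Lemma definable_subset {U : ZF_model} i j :
  definable (fun e : nat -> U => e i ⊆ e j).
Proof. unfold subset. definability. Qed.

Lemma definable_upair {U : ZF_model} i j k :
  definable (fun e : nat -> U => e i = upair (e j) (e k)).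
Proof.
  apply (definable_ext (fun e => forall x, x ∈ e i <-> x = e j \/ x = e k)).
  - definability.
  - intro e. symmetry. apply eq_upair.
Qed.
Hint Resolve definable_subset definable_upair : definability.

(** The language has no terms, so the inner unordered pairs are named by existential quantifiers. *)
Lemma definable_eq_opair {U : ZF_model} i j k :
  definable (fun e : nat -> U => e i = opair (e j) (e k)).
Proof.
  apply (definable_ext (fun e => exists u v,
    u = upair (e j) (e j) /\ v = upair (e j) (e k) /\ e i = upair u v)).
  - definability.
  - intro e. split.
    + intros (u & v & -> & -> & H). exact H.
    + intro H. eauto.
Qed.
Hint Resolve definable_eq_opair : definability.

Lemma definable_opair_mem {U : ZF_model} i j k :
  definable (fun e : nat -> U => opair (e i) (e j) ∈ e k).
Proof.
  apply (definable_ext (fun e => exists q, q = opair (e i) (e j) /\ q ∈ e k)).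
  - definability.
  - intro e. split.
    + intros (q & -> & H). exact H.
    + intro H. eauto.
Qed.
Hint Resolve definable_opair_mem : definability.

Lemma definable_function {U : ZF_model} i j k :
  definable (fun e : nat -> U => function (e i) (e j) (e k)).
Proof. unfold function. definability. Qed.
Hint Resolve definable_function : definability.

Lemma definable_bijection {U : ZF_model} i j k :
  definable (fun e : nat -> U => bijection (e i) (e j) (e k)).
Proof. unfold bijection. definability. Qed.
Hint Resolve definable_bijection : definability.

Lemma definable_inductive {U : ZF_model} i :
  definable (fun e : nat -> U => inductive (e i)).
Proof.
  apply (definable_ext (fun e =>
    (exists o, (forall x, ~ x ∈ o) /\ o ∈ e i) /\
    forall x, x ∈ e i ->
      exists s, (forall y, y ∈ s <-> y ∈ x \/ y = x) /\ s ∈ e i)).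
  - definability.
  - intro e. unfold inductive. split.
    + intros [[o [Ho H0]] HS]. split.
      * apply eq_empty in Ho. subst o. exact H0.
      * intros x Hx. destruct (HS x Hx) as [s [Hs H]].
        apply eq_succ in Hs. subst s. exact H.
    + intros [H0 HS]. split.
      * exists empty. split; [apply eq_empty; reflexivity | exact H0].
      * intros x Hx. exists (succ x).
        split; [apply eq_succ; reflexivity | auto].
Qed.
Hint Resolve definable_inductive : definability.

(** * Finite sets *)

(** The axiom of infinity gives one inductive set, and [omega] is separated from it. *)
Lemma mem_omega {U : ZF_model} (n : U) :
  n ∈ omega <-> forall w, inductive w -> n ∈ w.
Proof.
  destruct (zf_infinity U) as [w [[o [Ho Hemp]] HS]].
  assert (Hw : inductive w).
  { split.
    - apply eq_empty in Hemp. subst o. exact Ho.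
    - intros x Hx. destruct (HS x Hx) as [s [Hs H]].
      apply eq_succ in H. subst s. exact Hs. }
  unfold omega.
  apply (mem_setof_bounded (fun n => _)
    (fun e => forall w, inductive w -> e 0 ∈ w) (fun _ => w) w).
  - definability.
  - intro x. simpl. split; [auto | intros [_ H]; exact H].
Qed.

Lemma empty_in_omega {U : ZF_model} : @empty U ∈ omega.
Proof. apply mem_omega. intros w [H _]. exact H. Qed.

Lemma succ_in_omega {U : ZF_model} (n : U) : n ∈ omega -> succ n ∈ omega.
Proof.
  rewrite !mem_omega. intros H w Hw. destruct Hw as [H0 HS].
  apply HS, H. split; assumption.
Qed.

Lemma empty_neq_one {U : ZF_model} : @empty U <> succ empty.
Proof. intro H. apply (mem_empty (@empty U)). rewrite H at 2. apply mem_succ. auto. Qed.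

Lemma mem_two {U : ZF_model} (x : U) : x ∈ two <-> x = empty \/ x = succ empty.
Proof. apply mem_upair. Qed.

Lemma two_in_omega {U : ZF_model} : @two U ∈ omega.
Proof.
  replace (@two U) with (succ (succ (@empty U))).
  - apply succ_in_omega, succ_in_omega, empty_in_omega.
  - symmetry. apply eq_succ. intro x. rewrite mem_two, mem_succ.
    pose proof (mem_empty x). tauto.
Qed.

Lemma finite_empty {U : ZF_model} : finite (@empty U).
Proof.
  exists empty, empty. split; [apply empty_in_omega|].
  repeat split; intros x Hx; destruct (mem_empty _ Hx).
Qed.

Lemma finite_singleton {U : ZF_model} (a : U) : finite (upair a a).
Proof.
  exists (succ empty), (upair (opair empty a) (opair empty a)).
  split; [apply succ_in_omega, empty_in_omega|].
  assert (E : forall x, x ∈ succ (@empty U) <-> x = empty).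
  { intro x. rewrite mem_succ. pose proof (mem_empty x). tauto. }
  repeat split.
  - intros q Hq. exists empty, a. rewrite E, mem_upair in *. tauto.
  - intros x Hx. apply E in Hx. subst x. exists a. split.
    + apply mem_upair. auto.
    + intros b Hb. rewrite mem_upair, !opair_inj in Hb. intuition congruence.
  - intros b Hb. apply mem_upair in Hb. exists empty. split.
    + apply mem_upair. rewrite opair_inj. tauto.
    + intros x Hx. rewrite mem_upair, !opair_inj in Hx. intuition congruence.
Qed.

Lemma finite_upair {U : ZF_model} (a b : U) : finite (upair a b).
Proof.
  (* If [a = b], the pair has one element and is not in bijection with [two]. *)
  destruct (classic (a = b)) as [<- | Hab]; [apply finite_singleton|].
  exists two, (upair (opair empty a) (opair (succ empty) b)).
  split; [apply two_in_omega|]. pose proof (@empty_neq_one U) as N.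
  repeat split.
  - intros q Hq. apply mem_upair in Hq. destruct Hq as [-> | ->].
    + exists empty, a. rewrite mem_two, mem_upair. tauto.
    + exists (succ empty), b. rewrite mem_two, mem_upair. tauto.
  - intros x Hx. apply mem_two in Hx. destruct Hx as [-> | ->];
      [exists a | exists b]; (split; [apply mem_upair; auto|]);
      intros y Hy; rewrite mem_upair, !opair_inj in Hy; intuition congruence.
  - intros y Hy. apply mem_upair in Hy. destruct Hy as [-> | ->];
      [exists empty | exists (succ empty)]; (split; [apply mem_upair; auto|]);
      intros x Hx; rewrite mem_upair, !opair_inj in Hx; intuition congruence.
Qed.

Lemma mem_finite_subsets {U : ZF_model} (X a : U) :
  a ∈ finite_subsets X <-> a ⊆ X /\ finite a.
Proof.
  unfold finite_subsets.
  apply (mem_setof_bounded (fun a => _)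
    (* Variable 1 holds [omega] itself as a parameter, which avoids a formula defining it. *)
    (fun e => exists n f, n ∈ e 1 /\ bijection n (e 0) f)
    (fun _ => omega) (power X)).
  - definability.
  - intro x. rewrite mem_power. reflexivity.
Qed.

(** * Functions into 2 *)

Lemma mem_pow2 {U : ZF_model} (A f : U) : f ∈ pow2 A <-> function A two f.
Proof.
  destruct (product_bound A two) as [C HC]. unfold pow2.
  apply (mem_setof_bounded (function A two)
    (fun e => function (e 1) (e 2) (e 0)) (scons A (fun _ => two)) (power C)).
  - definability.
  - intro x. rewrite mem_power. simpl. split; [|tauto].
    intro Hf. split; [|exact Hf]. intros q Hq.
    destruct (proj1 Hf q Hq) as (a & b & Ha & Hb & ->). auto.
Qed.

(** This is f(x) = 1. It turns a function into 2 into a predicate, so that later arguments become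
    propositional. *)
Definition on {U : ZF_model} (f x : U) : Prop := opair x (succ empty) ∈ f.

Lemma pow2_off {U : ZF_model} (A f x : U) :
  f ∈ pow2 A -> x ∈ A -> (opair x empty ∈ f <-> ~ on f x).
Proof.
  intros Hf Hx. apply mem_pow2 in Hf. destruct Hf as [Hf1 Hf2].
  destruct (Hf2 x Hx) as [b [Hb Ub]]. unfold on. split.
  - intros H0 H1. apply (@empty_neq_one U).
    transitivity b; [symmetry|]; apply Ub; assumption.
  - intro H. destruct (Hf1 _ Hb) as (x' & b' & _ & Hb' & E).
    apply opair_inj in E. destruct E as [_ <-].
    apply mem_two in Hb'. destruct Hb' as [-> | ->]; tauto.
Qed.

(** Inclusion of graphs preserves the value 1 directly and the value 0 through [pow2_off]; together
    these give both directions of the equivalence at each point of [z]. *)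
Lemma pow2_subset {U : ZF_model} (z X p f : U) :
  z ⊆ X -> p ∈ pow2 z -> f ∈ pow2 X ->
  (p ⊆ f <-> forall x, x ∈ z -> (on p x <-> on f x)).
Proof.
  intros HzX Hp Hf. split.
  - intros H x Hx. split; [apply H|]. intro Hfx.
    apply NNPP. rewrite <- (pow2_off _ _ _ Hp Hx). intro H0.
    apply H in H0. apply (pow2_off _ _ _ Hf (HzX _ Hx)) in H0. auto.
  - intros H q Hq. pose proof Hp as Hp'.
    apply mem_pow2 in Hp'. destruct (proj1 Hp' q Hq) as (x & b & Hx & Hb & ->).
    specialize (H x Hx). apply mem_two in Hb. destruct Hb as [-> | ->].
    + apply (pow2_off _ _ _ Hf (HzX _ Hx)). rewrite <- H.
      apply (pow2_off _ _ _ Hp Hx). exact Hq.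
    + apply H. exact Hq.
Qed.

Lemma pow2_ext {U : ZF_model} (X f g : U) :
  f ∈ pow2 X -> g ∈ pow2 X -> (forall x, x ∈ X -> (on f x <-> on g x)) -> f = g.
Proof.
  intros Hf Hg H. assert (HX : X ⊆ X) by (intros x Hx; exact Hx).
  apply zf_extensionality. intro q. split.
  - apply (pow2_subset X X f g HX Hf Hg), H.
  - apply (pow2_subset X X g f HX Hg Hf). intros x Hx. symmetry. auto.
Qed.

Lemma characteristic_function {U : ZF_model} (A S : U) :
  exists f, f ∈ pow2 A /\ forall x, x ∈ A -> (on f x <-> x ∈ S).
Proof.
  destruct (product_bound A two) as [C HC].
  (* Variables 1 to 4 hold [A], [S], 0 and 1. *)
  destruct (separation (fun e : nat -> U => exists x b, x ∈ e 1 /\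
      (x ∈ e 2 /\ b = e 4 \/ ~ x ∈ e 2 /\ b = e 3) /\ e 0 = opair x b)
    (scons A (scons S (scons empty (fun _ => succ empty)))) C) as [f Hf];
    [definability|].
  simpl in Hf.
  assert (Hop : forall x b, opair x b ∈ f <-> x ∈ A /\
    (x ∈ S /\ b = succ empty \/ ~ x ∈ S /\ b = empty)).
  { intros x b. rewrite Hf. split.
    - intros [_ (x' & b' & Hx & Hb & E)]. apply opair_inj in E.
      destruct E as [-> ->]. auto.
    - intros [Hx Hb]. split; [|eauto].
      apply HC; [exact Hx|]. apply mem_two. tauto. }
  exists f. split.
  - apply mem_pow2. split.
    + intros q Hq. apply Hf in Hq. destruct Hq as [_ (x & b & Hx & Hb & ->)].
      exists x, b. rewrite mem_two. tauto.
    + intros x Hx. destruct (classic (x ∈ S)) as [H | H];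
        [exists (succ empty) | exists empty]; (split; [apply Hop; tauto|]);
        intros y Hy; apply Hop in Hy; symmetry; tauto.
  - intros x Hx. unfold on. rewrite Hop. pose proof (@empty_neq_one U).
    intuition congruence.
Qed.

Lemma mem_basic {U : ZF_model} (X p f : U) :
  f ∈ basic X p <-> f ∈ pow2 X /\ p ⊆ f.
Proof.
  unfold basic.
  apply (mem_setof_bounded (fun f => _) (fun e => e 1 ⊆ e 0) (fun _ => p) (pow2 X)).
  - definability.
  - simpl. tauto.
Qed.

(** * The topology *)

Lemma mem_tau2_basic {U : ZF_model} (X Z V : U) :
  V ∈ tau2 X Z <-> V ⊆ pow2 X /\
    forall f, f ∈ V ->
      exists z, z ∈ Z /\ z <> empty /\
        exists p, p ∈ pow2 z /\ f ∈ basic X p /\ basic X p ⊆ V.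
Proof.
  unfold tau2.
  apply (mem_setof_bounded (fun V => _)
    (* Variables 1 to 4 hold [Z], the empty set, [two] and [pow2 X]; membership in [pow2 z] and in
       [basic X p] is spelled out, since [z] and [p] are bound. *)
    (fun e => forall f, f ∈ e 0 -> exists z, z ∈ e 1 /\ z <> e 2 /\
      exists p, function z (e 3) p /\ (f ∈ e 4 /\ p ⊆ f) /\
        forall g, (g ∈ e 4 /\ p ⊆ g) -> g ∈ e 0)
    (scons Z (scons empty (scons two (fun _ => pow2 X)))) (power (pow2 X))).
  - definability.
  - intro W. rewrite mem_power. simpl. unfold subset at 2.
    setoid_rewrite mem_basic. setoid_rewrite mem_pow2. reflexivity.
Qed.

Definition agree {U : ZF_model} (z f g : U) : Prop :=
  forall x, x ∈ z -> (on g x <-> on f x).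

(** If [f] lies in the basic set of [p], with [p] defined on [z], then [p] is the restriction of [f]
    to [z], and that basic set consists of the functions agreeing with [f] on [z]. This eliminates
    [p]. *)
Lemma mem_tau2 {U : ZF_model} (X Z V : U) (hZ : Z ⊆ power X) :
  V ∈ tau2 X Z <-> V ⊆ pow2 X /\
    forall f, f ∈ V ->
      exists z, z ∈ Z /\ z <> empty /\
        forall g, g ∈ pow2 X -> agree z f g -> g ∈ V.
Proof.
  rewrite mem_tau2_basic. split; intros [HV H]; (split; [exact HV|]);
    intros f Hf; destruct (H f Hf) as (z & Hz & Hne & Hrest);
    exists z; (split; [exact Hz|]); (split; [exact Hne|]);
    pose proof (proj1 (mem_power _ _) (hZ _ Hz)) as HzX.
  - destruct Hrest as (p & Hp & Hfp & Hsub). intros g Hg Hag.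
    apply mem_basic in Hfp. destruct Hfp as [Hf2 Hpf].
    apply Hsub, mem_basic. split; [exact Hg|].
    apply (pow2_subset z X p g HzX Hp Hg). intros x Hx. rewrite (Hag x Hx).
    apply (pow2_subset z X p f HzX Hp Hf2); assumption.
  (* The restriction of [f] to [z] is rebuilt as the characteristic function of the points of [z]
     where [f] is 1. *)
  - destruct (separation (fun e : nat -> U => opair (e 0) (e 1) ∈ e 2)
      (scons (succ empty) (fun _ => f)) z) as [S HS]; [definability|].
    simpl in HS. destruct (characteristic_function z S) as (p & Hp & Hpon).
    assert (Hpf : forall x, x ∈ z -> (on p x <-> on f x)).
    { intros x Hx. rewrite (Hpon x Hx), HS. unfold on. tauto. }
    exists p. split; [exact Hp|]. split.
    + apply mem_basic. split; [auto|].
      apply (pow2_subset z X p f HzX Hp (HV _ Hf)), Hpf.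
    + intros g Hg. apply mem_basic in Hg. destruct Hg as [Hg Hpg].
      apply Hrest; [exact Hg|]. intros x Hx. rewrite <- (Hpf x Hx).
      symmetry. apply (pow2_subset z X p g HzX Hp Hg); assumption.
Qed.

Lemma tau2_topology {U : ZF_model} (X Z : U) (hX : infinite X)
    (hZ : Z ⊆ power X) (hZunion : closed_under_finite_unions Z)
    (hZfin : finite_subsets X ⊆ Z) :
  is_topology (pow2 X) (tau2 X Z).
Proof.
  repeat split.
  - intros V HV. apply mem_power. apply (mem_tau2 X Z V hZ) in HV. apply HV.
  - apply mem_tau2; [exact hZ|].
    split; intros f Hf; destruct (mem_empty _ Hf).
  - apply mem_tau2; [exact hZ|]. split; [intros f Hf; exact Hf|].
    intros f Hf.
    (* Openness of the whole space needs some nonempty member of [Z]; a singleton from the infinite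
       set [X] will do. *)
    assert (Hne : exists x, x ∈ X).
    { apply neq_empty. intros ->. exact (hX finite_empty). }
    destruct Hne as [x Hx]. exists (upair x x). split; [|split].
    + apply hZfin, mem_finite_subsets. split; [|apply finite_singleton].
      intros y Hy. apply mem_upair in Hy. destruct Hy as [-> | ->]; exact Hx.
    + apply neq_empty. exists x. apply mem_upair. auto.
    + auto.
  - intros A HA. apply mem_tau2; [exact hZ|]. split.
    + intros f Hf. apply mem_union in Hf. destruct Hf as (V & HV & Hf).
      apply HA, (mem_tau2 X Z V hZ) in HV. apply HV, Hf.
    + intros f Hf. apply mem_union in Hf. destruct Hf as (V & HV & Hf).
      pose proof (HA V HV) as HVo. apply (mem_tau2 X Z V hZ) in HVo.
      destruct (proj2 HVo f Hf) as (z & Hz & Hne & H).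
      exists z. split; [exact Hz|]. split; [exact Hne|].
      intros g Hg Hag. apply mem_union. exists V. auto.
  - intros V W HV HW. apply (mem_tau2 X Z V hZ) in HV.
    apply (mem_tau2 X Z W hZ) in HW. apply mem_tau2; [exact hZ|]. split.
    + intros f Hf. apply mem_inter in Hf. apply HV, Hf.
    + intros f Hf. apply mem_inter in Hf. destruct Hf as [HfV HfW].
      destruct (proj2 HV f HfV) as (z & Hz & Hne & H).
      destruct (proj2 HW f HfW) as (z' & Hz' & _ & H').
      (* Agreement on the union of [z] and [z'] gives agreement on each of them. *)
      exists (union (upair z z')). split; [|split].
      * apply hZunion; [|apply finite_upair].
        intros y Hy. apply mem_upair in Hy. destruct Hy as [-> | ->]; assumption.
      * apply neq_empty in Hne. destruct Hne as [x Hx].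
        apply neq_empty. exists x. apply mem_union_upair. auto.
      * intros g Hg Hag. apply mem_inter.
        split; [apply H | apply H']; try exact Hg; intros x Hx;
          apply Hag, mem_union_upair; auto.
Qed.

(** * Translations *)

(** [translated X u v f g] says [g = f + u + v (mod 2)] on [X]. *)
Definition translated {U : ZF_model} (X u v f g : U) : Prop :=
  forall x, x ∈ X -> (on g x <-> (on f x <-> (on u x <-> on v x))).

(** Adding u + v twice cancels modulo 2. *)
Lemma translated_sym {U : ZF_model} (X u v f g : U) :
  translated X u v f g -> translated X u v g f.
Proof. intros H x Hx. specialize (H x Hx). tauto. Qed.

(** On truth values an equivalence is the sum plus 1, so the two nested equivalences give exactly f
    + u + v. The set where this is 1 is separated from [X]. *)
Lemma translated_exists {U : ZF_model} (X u v f : U) :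
  exists g, g ∈ pow2 X /\ translated X u v f g.
Proof.
  destruct (separation (fun e : nat -> U =>
      opair (e 0) (e 1) ∈ e 2 <->
      (opair (e 0) (e 1) ∈ e 3 <-> opair (e 0) (e 1) ∈ e 4))
    (scons (succ empty) (scons f (scons u (fun _ => v)))) X) as [S HS];
    [definability|].
  simpl in HS. destruct (characteristic_function X S) as (g & Hg & Hon).
  exists g. split; [exact Hg|]. intros x Hx.
  rewrite (Hon x Hx), HS. unfold on. tauto.
Qed.

Lemma translated_unique {U : ZF_model} (X u v f g g' : U) :
  g ∈ pow2 X -> g' ∈ pow2 X -> translated X u v f g -> translated X u v f g' ->
  g = g'.
Proof.
  intros Hg Hg' H H'. apply (pow2_ext X); try assumption.
  intros x Hx. rewrite (H x Hx), (H' x Hx). reflexivity.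
Qed.

Lemma translation_graph {U : ZF_model} (X u v : U) :
  exists h,
    (forall q, q ∈ h -> exists f g, q = opair f g) /\
    forall f g, opair f g ∈ h <->
      f ∈ pow2 X /\ g ∈ pow2 X /\ translated X u v f g.
Proof.
  destruct (product_bound (pow2 X) (pow2 X)) as [C HC].
  destruct (separation (fun e : nat -> U => exists f g, e 0 = opair f g /\
      f ∈ e 1 /\ g ∈ e 1 /\ forall x, x ∈ e 2 ->
        (opair x (e 3) ∈ g <->
          (opair x (e 3) ∈ f <-> (opair x (e 3) ∈ e 4 <-> opair x (e 3) ∈ e 5))))
    (* The body of [translated] is written out in the formula, with these five sets as variables 1
       to 5. *)
    (scons (pow2 X) (scons X (scons (succ empty) (scons u (fun _ => v))))) C)
    as [h Hh]; [definability|].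
  simpl in Hh. exists h. split.
  - intros q Hq. apply Hh in Hq. destruct Hq as [_ (f & g & E & _)]. eauto.
  - intros f g. rewrite Hh. split.
    + intros [_ (f' & g' & E & H)]. apply opair_inj in E.
      destruct E as [-> ->]. exact H.
    + intros (Hf & Hg & H). split; [auto|].
      exists f, g. auto.
Qed.

(** * Translations are homeomorphisms *)

Lemma mem_preimage {U : ZF_model} (S h V x : U) :
  (forall x y, opair x y ∈ h -> x ∈ S) ->
  (x ∈ preimage h V <-> exists y, y ∈ V /\ opair x y ∈ h).
Proof.
  intro HS. unfold preimage.
  apply (mem_setof_bounded (fun x => _)
    (fun e => exists y, y ∈ e 1 /\ opair (e 0) y ∈ e 2)
    (scons V (fun _ => h)) S).
  - definability.
  - simpl. firstorder.
Qed.

Lemma converse_symmetric {U : ZF_model} (h : U) :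
  (forall q, q ∈ h -> exists x y, q = opair x y) ->
  (forall x y, opair x y ∈ h -> opair y x ∈ h) ->
  converse h = h.
Proof.
  intros Hrel Hsym.
  assert (H : forall q, (exists x y, opair x y ∈ h /\ q = opair y x) <-> q ∈ h).
  { intro q. split.
    - intros (x & y & Hxy & ->). auto.
    - intro Hq. destruct (Hrel q Hq) as (x & y & ->). eauto. }
  apply zf_extensionality. intro q. rewrite <- H. unfold converse.
  (* [h] itself witnesses that the set defining [converse h] exists. *)
  apply (mem_setof (fun q => _)). exists h. intro r. symmetry. apply H.
Qed.

(** The graph is symmetric, so [h] is its own inverse: bijectivity follows from being a function,
    and continuity of the converse from that of [h]. *)
Lemma translation_homeomorphism {U : ZF_model} (X Z u v h : U)
    (hZ : Z ⊆ power X)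
    (Hrel : forall q, q ∈ h -> exists f g, q = opair f g)
    (Hh : forall f g, opair f g ∈ h <->
      f ∈ pow2 X /\ g ∈ pow2 X /\ translated X u v f g) :
  homeomorphism (pow2 X) (tau2 X Z) (pow2 X) (tau2 X Z) h.
Proof.
  assert (Hsym : forall f g, opair f g ∈ h -> opair g f ∈ h).
  { intros f g. rewrite !Hh. intros (Hf & Hg & H).
    auto using translated_sym. }
  assert (Huniq : forall f, f ∈ pow2 X -> exists! g, opair f g ∈ h).
  { intros f Hf. destruct (translated_exists X u v f) as (g & Hg & H).
    exists g. split; [apply Hh; auto|].
    intros g' Hg'. apply Hh in Hg'. destruct Hg' as (_ & Hg' & H').
    exact (translated_unique X u v f g g' Hg Hg' H H'). }
  assert (Hfun : function (pow2 X) (pow2 X) h).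
  { split; [|exact Huniq]. intros q Hq. destruct (Hrel q Hq) as (f & g & ->).
    apply Hh in Hq. exists f, g. tauto. }
  assert (Hcont : continuous (pow2 X) (tau2 X Z) (pow2 X) (tau2 X Z) h).
  { split; [exact Hfun|]. intros V HV. apply (mem_tau2 X Z V hZ) in HV.
    assert (Hpre : forall f, f ∈ preimage h V <-> exists g, g ∈ V /\ opair f g ∈ h).
    { intro f. apply (mem_preimage (pow2 X)).
      intros f' g' H. apply Hh in H. apply H. }
    apply mem_tau2; [exact hZ|]. split.
    - intros f Hf. apply Hpre in Hf. destruct Hf as (g & _ & H).
      apply Hh in H. apply H.
    - intros f Hf. apply Hpre in Hf. destruct Hf as (g & HgV & H).
      apply Hh in H. destruct H as (Hf & Hg & Hfg).
      destruct (proj2 HV g HgV) as (z & Hz & Hne & HzV).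
      (* The [z] that works for the image [g] in [V] also works for [f]: functions agreeing on [z]
         have translates agreeing on [z]. *)
      exists z. split; [exact Hz|]. split; [exact Hne|].
      intros f' Hf' Hag. destruct (translated_exists X u v f') as (g' & Hg' & H').
      apply Hpre. exists g'. split; [|apply Hh; auto].
      apply HzV; [exact Hg'|]. intros x Hx.
      assert (HxX : x ∈ X) by (apply (proj1 (mem_power _ _) (hZ _ Hz)), Hx).
      rewrite (H' x HxX), (Hfg x HxX), (Hag x Hx). reflexivity. }
  split; [|split].
  - split; [exact Hfun|]. intros g Hg. destruct (Huniq g Hg) as [f [Hf Uf]].
    exists f. split; [auto|]. intros f' Hf'. apply Uf. auto.
  - exact Hcont.
  - rewrite (converse_symmetric h Hrel Hsym). exact Hcont.
Qed.

Theorem theorem4p8 (U : ZF_model) (X Z : U)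
    (hX : infinite X)
    (hZ : Z ⊆ power X)
    (hZunion : closed_under_finite_unions Z)
    (hZfin : finite_subsets X ⊆ Z) :
  homogeneous (pow2 X) (tau2 X Z).
Proof.
  split; [apply tau2_topology; assumption|].
  intros x1 x2 Hx1 Hx2 _.
  destruct (translation_graph X x1 x2) as (h & Hrel & Hh).
  exists h. split; [exact (translation_homeomorphism X Z x1 x2 h hZ Hrel Hh)|].
  apply Hh. split; [exact Hx1|]. split; [exact Hx2|].
  (* Modulo 2, x1 + x1 + x2 = x2. *)
  intros x _. tauto.
Qed.
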